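(* Let $(\Omega,\mathcal{F},P)$ be a probability space and let $(E,\|\cdot\|)$ be a random normed module over $\mathbb{C}$ with base $(\Omega,\mathcal{F},P)$ such that $E$ has the countable concatenation property. Let $J:E\to E^{**}$ be the random natural embedding, defined by $J(x)(g)=g(x)$ for all $x\in E$ and $g\in E^{*}$. Then the closure of $J(E)$ in $E^{**}$ with respect to the locally $L^{0}$-convex weak star topology $\sigma_{c}(E^{**},E^{*})$ is $E^{**}$.
   Context: $L^{0}(\mathcal{F},K)$ ($K=\mathbb{R}$ or $\mathbb{C}$) is the algebra of a.s.-equivalence classes of $K$-valued $\mathcal{F}$-measurable functions on $\Omega$. $L^0(\mathcal{F},\mathbb{R})$ is ordered by $\xi\leqslant\eta$ iff $\xi\leqslant\eta$ a.s.; suprema $\vee$ are taken in this (Dedekind complete) order. $L^{0}_{+}=\{\xi\in L^{0}(\mathcal{F},\mathbb{R}):\xi\geqslant 0\}$, and $L^{0}_{++}=\{\xi\in L^0(\mathcal{F},\mathbb{R}):\xi>0 \text{ a.s. on }\Omega\}$. $\tilde I_A$ is the class of the indicator function of $A\in\mathcal{F}$. Random normed (RN) module over $K$ with base $(\Omega,\mathcal{F},P)$: a left module $E$ over the algebra $L^{0}(\mathcal{F},K)$ with a map $\|\cdot\|:E\to L^{0}_{+}$ such that $\|x\|=0$ iff $x=0$; $\|\xi x\|=|\xi|\,\|x\|$ for $\xi\in L^{0}(\mathcal{F},K)$, $x\in E$; and $\|x+y\|\leqslant\|x\|+\|y\|$. Countable concatenation property of $E$: for every sequence $(x_n)_{n\geq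 1}$ in $E$ and every countable partition $(A_n)_{n\geq 1}$ of $\Omega$ into sets of $\mathcal{F}$ there is $x\in E$ with $\tilde I_{A_n}x=\tilde I_{A_n}x_n$ for all $n$. Random conjugate space $E^{*}$: all linear operators $f:E\to L^{0}(\mathcal{F},K)$ for which there is $\xi\in L^{0}_{+}$ with $|f(x)|\leqslant\xi\|x\|$ for all $x\in E$; it is an RN module under $(\xi\cdot f)(x)=\xi f(x)$ and $\|f\|^{*}=\vee\{|f(y)|: y\in E,\ \|y\|\leqslant 1\}$. $E^{**}=(E^{*})^{*}$. For an RN module $F$ (applied here with $F=E^{*}$), the locally $L^{0}$-convex weak star topology $\sigma_{c}(F^{*},F)$ on $F^{*}$ is the translation-invariant topology having as a neighborhood base at $0$ the sets $\{g\in F^{*}: |g(y_i)|<\epsilon \text{ a.s. on }\Omega,\ 1\leqslant i\leqslant n\}$, for $n\geq 1$, $y_1,\dots,y_n\in F$, $\epsilon\in L^{0}_{++}$ (neighborhoods of other points are translates). *)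

(* Defs.v *)
From HB Require Import structures.
From mathcomp Require Import all_boot all_order all_algebra.
From mathcomp Require Import complex.
From mathcomp Require Import all_classical all_reals all_analysis.
From mathcomp Require Import measurable_realfun.

Set Implicit Arguments.
Unset Strict Implicit.
Unset Printing Implicit Defensive.

Import Order.TTheory GRing.Theory Num.Theory.
Import numFieldNormedType.Exports.
Local Open Scope classical_set_scope.
Local Open Scope ring_scope.

(* The Borel sigma-algebra of C, identified with R * R. *)
Section complex_measurable.
Variable R : realType.

Definition complex_pair (z : R[i]) : R * R := (complex.Re z, complex.Im z).

HB.instance Definition _ := isPointed.Build R[i] 0.

Let C0 : preimage_set_system [set: R[i]] complex_pair measurable set0.
Proof. by exists set0; rewrite ?preimage_set0 ?setI0. Qed.

Let C_setC A : preimage_set_system [set: R[i]] complex_pair measurable A ->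
  preimage_set_system [set: R[i]] complex_pair measurable (~` A).
Proof.
have [_ + _] := sigma_algebra_preimage setT complex_pair
  (sigma_algebra_measurable (R * R)%type).
by move=> /[apply]; rewrite setTD.
Qed.

Let C_bigcup (F : (set R[i])^nat) :
  (forall i, preimage_set_system [set: R[i]] complex_pair measurable (F i)) ->
  preimage_set_system [set: R[i]] complex_pair measurable (\bigcup_i F i).
Proof.
by have [_ _] := sigma_algebra_preimage setT complex_pair
  (sigma_algebra_measurable (R * R)%type); apply.
Qed.

HB.instance Definition _ :=
  isMeasurable.Build default_measure_display R[i] C0 C_setC C_bigcup.

Lemma measurable_complex_pair : measurable_fun [set: R[i]] complex_pair.
Proof. by move=> _ Y mY; exists Y. Qed.

Lemma measurable_Re : measurable_fun [set: R[i]] (@complex.Re R).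
Proof.
exact: (measurableT_comp measurable_fst measurable_complex_pair).
Qed.

Lemma measurable_Im : measurable_fun [set: R[i]] (@complex.Im R).
Proof.
exact: (measurableT_comp measurable_snd measurable_complex_pair).
Qed.

Lemma measurable_complexP d (T : measurableType d) (f : T -> R[i]) :
  measurable_fun [set: T] f <->
  measurable_fun [set: T] (fun x => complex.Re (f x)) /\
  measurable_fun [set: T] (fun x => complex.Im (f x)).
Proof.
split=> [mf|[mr mi] _ _ [Y mY <-]].
  by split; [exact: (measurableT_comp measurable_Re mf)
            |exact: (measurableT_comp measurable_Im mf)].
rewrite !setTI -[X in measurable X]setTI.
exact: (measurable_fun_pair mr mi).
Qed.

Lemma measurable_addc : measurable_fun [set: R[i] * R[i]] (fun z : R[i] * R[i] => z.1 + z.2).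
Proof.
have mr1 := measurableT_comp measurable_Re (@measurable_fst _ _ R[i] R[i]).
have mi1 := measurableT_comp measurable_Im (@measurable_fst _ _ R[i] R[i]).
have mr2 := measurableT_comp measurable_Re (@measurable_snd _ _ R[i] R[i]).
have mi2 := measurableT_comp measurable_Im (@measurable_snd _ _ R[i] R[i]).
apply/measurable_complexP; split.
- by rewrite [X in measurable_fun _ X](_ : _ =
    (@complex.Re R \o fst) \+ (@complex.Re R \o snd));
    [exact: measurable_funD|apply/funext => -[[a b] [c e]]].
- by rewrite [X in measurable_fun _ X](_ : _ =
    (@complex.Im R \o fst) \+ (@complex.Im R \o snd));
    [exact: measurable_funD|apply/funext => -[[a b] [c e]]].
Qed.

Lemma measurable_oppc : measurable_fun [set: R[i]] (fun x : R[i] => - x).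
Proof.
apply/measurable_complexP; split.
- by rewrite [X in measurable_fun _ X](_ : _ = -%R \o (@complex.Re R));
    [exact: (measurableT_comp (@oppr_measurable R setT) measurable_Re)
    |apply/funext => -[a b]].
- by rewrite [X in measurable_fun _ X](_ : _ = -%R \o (@complex.Im R));
    [exact: (measurableT_comp (@oppr_measurable R setT) measurable_Im)
    |apply/funext => -[a b]].
Qed.

Lemma measurable_mulc : measurable_fun [set: R[i] * R[i]] (fun z : R[i] * R[i] => z.1 * z.2).
Proof.
have mr1 := measurableT_comp measurable_Re (@measurable_fst _ _ R[i] R[i]).
have mi1 := measurableT_comp measurable_Im (@measurable_fst _ _ R[i] R[i]).
have mr2 := measurableT_comp measurable_Re (@measurable_snd _ _ R[i] R[i]).
have mi2 := measurableT_comp measurable_Im (@measurable_snd _ _ R[i] R[i]).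
apply/measurable_complexP; split.
- by rewrite [X in measurable_fun _ X](_ : _ =
      ((@complex.Re R \o fst) \* (@complex.Re R \o snd)) \-
      ((@complex.Im R \o fst) \* (@complex.Im R \o snd)));
    [apply: measurable_funB; exact: measurable_funM
    |apply/funext => -[[a b] [c e]]].
- by rewrite [X in measurable_fun _ X](_ : _ =
      ((@complex.Re R \o fst) \* (@complex.Im R \o snd)) \+
      ((@complex.Im R \o fst) \* (@complex.Re R \o snd)));
    [apply: measurable_funD; exact: measurable_funM
    |apply/funext => -[[a b] [c e]]].
Qed.

End complex_measurable.

Section L0_class.
Context (d dK : measure_display) (T : measurableType d) (R : realType) (P : probability T R).
Variable K : measurableType dK.

Definition L0_class (f : T -> K) (mf : measurable_fun [set: T] f) :
    {mfun_ P, T >-> K} :=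
  \pi_({mfun_ P, T >-> K})%qT (mfun_Sub (mem_set mf)).

Lemma measurable_L0 (f : {mfun_ P, T >-> K}) : measurable_fun [set: T] f.
Proof. exact: measurable_funPT. Qed.

Lemma L0_classE (f : T -> K) (mf : measurable_fun [set: T] f) :
  \forall w \ae P, L0_class mf w = f w.
Proof.
have : (repr (L0_class mf) == mfun_Sub (mem_set mf) %[mod {mfun_ P, T >-> K}])%qT.
  by rewrite reprK.
rewrite eqmodE => /asboolP; apply: filterS => w; exact.
Qed.

Lemma L0_eqP (f g : {mfun_ P, T >-> K}) : (\forall w \ae P, f w = g w) -> f = g.
Proof.
move=> fg; rewrite -[f]reprK -[g]reprK; apply/eqP; rewrite eqmodE.
by apply/asboolP; apply: filterS fg => w + _.
Qed.

End L0_class.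

Section L0_algebras.
Context d (T : measurableType d) (R : realType) (P : probability T R).

(* The a.s.-equivalence classes of R-valued and of C-valued measurable functions.
   The coercions to functions below pick a representative of a class, so only
   almost sure statements about them are meaningful. *)
Definition L0R : Type := {mfun_ P, T >-> R}.
Definition L0C : Type := {mfun_ P, T >-> R[i]}.

HB.instance Definition _ := Choice.on L0R.
HB.instance Definition _ := Choice.on L0C.

Definition L0R_fun (f : L0R) : T -> R := aqEqMfun_to_fun f.
Coercion L0R_fun : L0R >-> Funclass.
Definition L0C_fun (f : L0C) : T -> R[i] := aqEqMfun_to_fun f.
Coercion L0C_fun : L0C >-> Funclass.

Lemma L0R_eqP (f g : L0R) : (\forall w \ae P, f w = g w) -> f = g.
Proof. exact: L0_eqP. Qed.

Lemma L0C_eqP (f g : L0C) : (\forall w \ae P, f w = g w) -> f = g.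
Proof. exact: L0_eqP. Qed.

Lemma measurable_L0R (f : L0R) : measurable_fun [set: T] f.
Proof. exact: measurable_L0. Qed.

Lemma measurable_L0C (f : L0C) : measurable_fun [set: T] f.
Proof. exact: measurable_L0. Qed.

Definition L0R_class (f : T -> R) (mf : measurable_fun [set: T] f) : L0R :=
  L0_class P mf.
Definition L0C_class (f : T -> R[i]) (mf : measurable_fun [set: T] f) : L0C :=
  L0_class P mf.

Lemma L0R_classE (f : T -> R) (mf : measurable_fun [set: T] f) :
  \forall w \ae P, L0R_class mf w = f w.
Proof. exact: L0_classE. Qed.

Lemma L0C_classE (f : T -> R[i]) (mf : measurable_fun [set: T] f) :
  \forall w \ae P, L0C_class mf w = f w.
Proof. exact: L0_classE. Qed.

Let ae_proper : ProperFilter (almost_everywhere P).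
Proof.
apply: ae_properfilter_algebraOfSetsType.
by rewrite -[X in (_ < X)%E]/(P [set: T]) probability_setT lte01.
Qed.

Section real_operations.
Implicit Types f g h : L0R.

Let mN f : measurable_fun [set: T] (fun w => - f w).
Proof. exact: (measurableT_comp (@oppr_measurable R setT) (measurable_L0R f)). Qed.
Let mD f g : measurable_fun [set: T] (fun w => f w + g w).
Proof. by apply: measurable_funD; exact: measurable_L0R. Qed.
Let mM f g : measurable_fun [set: T] (fun w => f w * g w).
Proof. by apply: measurable_funM; exact: measurable_L0R. Qed.

Definition L0R0 : L0R := L0R_class (measurable_cst (0 : R)).
Definition L0R1 : L0R := L0R_class (measurable_cst (1 : R)).
Definition L0R_opp f : L0R := L0R_class (mN f).
Definition L0R_add f g : L0R := L0R_class (mD f g).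
Definition L0R_mul f g : L0R := L0R_class (mM f g).

Let E0 : \forall w \ae P, L0R0 w = 0. Proof. exact: L0R_classE. Qed.
Let E1 : \forall w \ae P, L0R1 w = 1. Proof. exact: L0R_classE. Qed.
Let EN f : \forall w \ae P, L0R_opp f w = - f w. Proof. exact: L0R_classE. Qed.
Let ED f g : \forall w \ae P, L0R_add f g w = f w + g w.
Proof. exact: L0R_classE. Qed.
Let EM f g : \forall w \ae P, L0R_mul f g w = f w * g w.
Proof. exact: L0R_classE. Qed.

Let addA : associative L0R_add.
Proof.
move=> f g h; apply: L0R_eqP; near=> w.
rewrite (near (ED f (L0R_add g h)) w)// (near (ED g h) w)//.
by rewrite (near (ED (L0R_add f g) h) w)// (near (ED f g) w)// addrA.
Unshelve. all: by end_near. Qed.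

Let addC : commutative L0R_add.
Proof.
move=> f g; apply: L0R_eqP; near=> w.
by rewrite (near (ED f g) w)// (near (ED g f) w)// addrC.
Unshelve. all: by end_near. Qed.

Let add0 : left_id L0R0 L0R_add.
Proof.
move=> f; apply: L0R_eqP; near=> w.
by rewrite (near (ED L0R0 f) w)// (near E0 w)// add0r.
Unshelve. all: by end_near. Qed.

Let addN : left_inverse L0R0 L0R_opp L0R_add.
Proof.
move=> f; apply: L0R_eqP; near=> w.
by rewrite (near (ED (L0R_opp f) f) w)// (near (EN f) w)// (near E0 w)// addNr.
Unshelve. all: by end_near. Qed.

Let mulA : associative L0R_mul.
Proof.
move=> f g h; apply: L0R_eqP; near=> w.
rewrite (near (EM f (L0R_mul g h)) w)// (near (EM g h) w)//.
by rewrite (near (EM (L0R_mul f g) h) w)// (near (EM f g) w)// mulrA.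
Unshelve. all: by end_near. Qed.

Let mulC : commutative L0R_mul.
Proof.
move=> f g; apply: L0R_eqP; near=> w.
by rewrite (near (EM f g) w)// (near (EM g f) w)// mulrC.
Unshelve. all: by end_near. Qed.

Let mul1 : left_id L0R1 L0R_mul.
Proof.
move=> f; apply: L0R_eqP; near=> w.
by rewrite (near (EM L0R1 f) w)// (near E1 w)// mul1r.
Unshelve. all: by end_near. Qed.

Let mulDl : left_distributive L0R_mul L0R_add.
Proof.
move=> f g h; apply: L0R_eqP; near=> w.
rewrite (near (EM (L0R_add f g) h) w)// (near (ED f g) w)//.
rewrite (near (ED (L0R_mul f h) (L0R_mul g h)) w)//.
by rewrite (near (EM f h) w)// (near (EM g h) w)// mulrDl.
Unshelve. all: by end_near. Qed.

Let one_neq0 : L0R1 != L0R0.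
Proof.
apply/eqP => e.
have [w /= [e0]] := @filter_ex _ _ ae_proper _ (filterI E0 E1).
by rewrite e e0 => /esym/eqP; rewrite oner_eq0.
Qed.

HB.instance Definition _ :=
  GRing.isZmodule.Build L0R addA addC add0 addN.
HB.instance Definition _ :=
  GRing.Zmodule_isComNzRing.Build L0R mulA mulC mul1 mulDl one_neq0.

Lemma L0R_0E : \forall w \ae P, (0 : L0R) w = 0. Proof. exact: E0. Qed.
Lemma L0R_1E : \forall w \ae P, (1 : L0R) w = 1. Proof. exact: E1. Qed.
Lemma L0R_NE f : \forall w \ae P, (- f : L0R) w = - f w. Proof. exact: EN. Qed.
Lemma L0R_DE f g : \forall w \ae P, (f + g : L0R) w = f w + g w.
Proof. exact: ED. Qed.
Lemma L0R_ME f g : \forall w \ae P, (f * g : L0R) w = f w * g w.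
Proof. exact: EM. Qed.

Definition L0R_le f g : bool := `[< \forall w \ae P, f w <= g w >].
Definition L0R_lt f g : bool := (g != f) && L0R_le f g.

Let le_def f g : L0R_lt f g = (g != f) && L0R_le f g. Proof. by []. Qed.

Let le_refl : reflexive L0R_le.
Proof. by move=> f; apply/asboolP; apply: aeW => w. Qed.

Let le_anti : antisymmetric L0R_le.
Proof.
move=> f g /andP[/asboolP fg /asboolP gf]; apply: L0R_eqP.
by apply: filterS2 fg gf => w fg gf; apply/eqP; rewrite eq_le fg gf.
Qed.

Let le_trans : transitive L0R_le.
Proof.
move=> g f h /asboolP fg /asboolP gh; apply/asboolP.
by apply: filterS2 fg gh => w; exact: le_trans.
Qed.

HB.instance Definition _ :=
  Order.isPOrder.Build ring_display L0R le_def le_refl le_anti le_trans.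

Lemma L0R_leP f g : (\forall w \ae P, f w <= g w) <-> f <= g.
Proof. by split => [|/asboolP]; [move=> ?; apply/asboolP|]. Qed.

End real_operations.

Section complex_operations.
Implicit Types f g h : L0C.

Let mN f : measurable_fun [set: T] (fun w => - f w).
Proof. exact: (measurableT_comp (@measurable_oppc R) (measurable_L0C f)). Qed.
Let mD f g : measurable_fun [set: T] (fun w => f w + g w).
Proof.
exact: (measurableT_comp (@measurable_addc R)
  (measurable_fun_pair (measurable_L0C f) (measurable_L0C g))).
Qed.
Let mM f g : measurable_fun [set: T] (fun w => f w * g w).
Proof.
exact: (measurableT_comp (@measurable_mulc R)
  (measurable_fun_pair (measurable_L0C f) (measurable_L0C g))).
Qed.

Definition L0C0 : L0C := L0C_class (measurable_cst (0 : R[i])).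
Definition L0C1 : L0C := L0C_class (measurable_cst (1 : R[i])).
Definition L0C_opp f : L0C := L0C_class (mN f).
Definition L0C_add f g : L0C := L0C_class (mD f g).
Definition L0C_mul f g : L0C := L0C_class (mM f g).

Let E0 : \forall w \ae P, L0C0 w = 0. Proof. exact: L0C_classE. Qed.
Let E1 : \forall w \ae P, L0C1 w = 1. Proof. exact: L0C_classE. Qed.
Let EN f : \forall w \ae P, L0C_opp f w = - f w. Proof. exact: L0C_classE. Qed.
Let ED f g : \forall w \ae P, L0C_add f g w = f w + g w.
Proof. exact: L0C_classE. Qed.
Let EM f g : \forall w \ae P, L0C_mul f g w = f w * g w.
Proof. exact: L0C_classE. Qed.

Let addA : associative L0C_add.
Proof.
move=> f g h; apply: L0C_eqP; near=> w.
rewrite (near (ED f (L0C_add g h)) w)// (near (ED g h) w)//.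
by rewrite (near (ED (L0C_add f g) h) w)// (near (ED f g) w)// addrA.
Unshelve. all: by end_near. Qed.

Let addC : commutative L0C_add.
Proof.
move=> f g; apply: L0C_eqP; near=> w.
by rewrite (near (ED f g) w)// (near (ED g f) w)// addrC.
Unshelve. all: by end_near. Qed.

Let add0 : left_id L0C0 L0C_add.
Proof.
move=> f; apply: L0C_eqP; near=> w.
by rewrite (near (ED L0C0 f) w)// (near E0 w)// add0r.
Unshelve. all: by end_near. Qed.

Let addN : left_inverse L0C0 L0C_opp L0C_add.
Proof.
move=> f; apply: L0C_eqP; near=> w.
by rewrite (near (ED (L0C_opp f) f) w)// (near (EN f) w)// (near E0 w)// addNr.
Unshelve. all: by end_near. Qed.

Let mulA : associative L0C_mul.
Proof.
move=> f g h; apply: L0C_eqP; near=> w.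
rewrite (near (EM f (L0C_mul g h)) w)// (near (EM g h) w)//.
by rewrite (near (EM (L0C_mul f g) h) w)// (near (EM f g) w)// mulrA.
Unshelve. all: by end_near. Qed.

Let mulC : commutative L0C_mul.
Proof.
move=> f g; apply: L0C_eqP; near=> w.
by rewrite (near (EM f g) w)// (near (EM g f) w)// mulrC.
Unshelve. all: by end_near. Qed.

Let mul1 : left_id L0C1 L0C_mul.
Proof.
move=> f; apply: L0C_eqP; near=> w.
by rewrite (near (EM L0C1 f) w)// (near E1 w)// mul1r.
Unshelve. all: by end_near. Qed.

Let mulDl : left_distributive L0C_mul L0C_add.
Proof.
move=> f g h; apply: L0C_eqP; near=> w.
rewrite (near (EM (L0C_add f g) h) w)// (near (ED f g) w)//.
rewrite (near (ED (L0C_mul f h) (L0C_mul g h)) w)//.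
by rewrite (near (EM f h) w)// (near (EM g h) w)// mulrDl.
Unshelve. all: by end_near. Qed.

Let one_neq0 : L0C1 != L0C0.
Proof.
apply/eqP => e.
have [w /= [e0]] := @filter_ex _ _ ae_proper _ (filterI E0 E1).
by rewrite e e0 => /esym/eqP; rewrite oner_eq0.
Qed.

HB.instance Definition _ :=
  GRing.isZmodule.Build L0C addA addC add0 addN.
HB.instance Definition _ :=
  GRing.Zmodule_isComNzRing.Build L0C mulA mulC mul1 mulDl one_neq0.

Lemma L0C_0E : \forall w \ae P, (0 : L0C) w = 0. Proof. exact: E0. Qed.
Lemma L0C_1E : \forall w \ae P, (1 : L0C) w = 1. Proof. exact: E1. Qed.
Lemma L0C_NE f : \forall w \ae P, (- f : L0C) w = - f w. Proof. exact: EN. Qed.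
Lemma L0C_DE f g : \forall w \ae P, (f + g : L0C) w = f w + g w.
Proof. exact: ED. Qed.
Lemma L0C_ME f g : \forall w \ae P, (f * g : L0C) w = f w * g w.
Proof. exact: EM. Qed.

Lemma measurable_normc : measurable_fun [set: R[i]] (@ComplexField.Normc.normc R).
Proof.
rewrite (_ : @ComplexField.Normc.normc R = @Num.sqrt R \o
  ((fun z => complex.Re z ^+ 2) \+ (fun z => complex.Im z ^+ 2))); last first.
  by apply/funext => -[a b].
apply: measurableT_comp.
  exact: (continuous_measurable_fun (@sqrt_continuous R)).
by apply: measurable_funD; apply: measurable_funX;
  [exact: measurable_Re|exact: measurable_Im].
Qed.

Let mabs f : measurable_fun [set: T] (fun w => ComplexField.Normc.normc (f w)).
Proof. exact: (measurableT_comp measurable_normc (measurable_L0C f)). Qed.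

Definition L0_abs f : L0R := L0R_class (mabs f).

Lemma L0_absE f : \forall w \ae P, L0_abs f w = ComplexField.Normc.normc (f w).
Proof. exact: L0R_classE. Qed.

End complex_operations.

Section indicator.
Variables (A : set T) (mA : measurable A).

Let mI : measurable_fun [set: T] (fun w => (\1_A w : R)%:C%C).
Proof.
by apply/measurable_complexP; split => //=; exact: measurable_indic.
Qed.

Definition L0_indic : L0C := L0C_class mI.

Lemma L0_indicE : \forall w \ae P, L0_indic w = (\1_A w)%:C%C.
Proof. exact: L0C_classE. Qed.

End indicator.
End L0_algebras.

Lemma measurable_invr (R : realType) : measurable_fun [set: R] (@GRing.inv R).
Proof.
rewrite (_ : GRing.inv = fun x : R => if x != 0 then x^-1 else 0); last first.
  by apply/funext => x; case: eqP => //= ->; rewrite invr0.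
apply: measurable_fun_if => //.
- rewrite (_ : (fun x => _) = negb \o (fun x : R => x == 0))//.
  by apply: measurableT_comp => //; exact: measurable_fun_eqr.
- rewrite setTI; apply: open_continuous_measurable_fun.
    rewrite (_ : _ @^-1` _ = ~` [set 0]); last first.
      by apply/seteqP; split=> x /=; [move=> /eqP|move=> /eqP].
    by apply: closed_openC; exact: closed_eq.
  by move=> x; rewrite inE/= => x0; exact: inv_continuous.
Qed.

Section Dedekind_completeness.
Context d (T : measurableType d) (R : realType) (P : probability T R).
Variable A : set (L0R P).
Hypotheses (f0 : L0R P) (Af0 : A f0) (b : L0R P) (Ab : ubound A b).

Let lo (w : T) : R := f0 w.
Let hi (w : T) : R := Num.max (lo w) (b w).
Let clip (x : R) (w : T) : R := Num.min (Num.max x (lo w)) (hi w).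

Let lo_le_hi w : lo w <= hi w. Proof. by rewrite le_max lexx. Qed.

Let clip_ge x w : lo w <= clip x w.
Proof. by rewrite le_min lo_le_hi le_max lexx orbT. Qed.

Let clip_le x w : clip x w <= hi w. Proof. by rewrite ge_min lexx orbT. Qed.

Let S (u : (L0R P)^nat) (w : T) : R := sups (fun n => clip (u n w) w) 0.

Implicit Types u v : (L0R P)^nat.

Let has_ub u w : has_ubound (range (fun n => clip (u n w) w)).
Proof. by exists (hi w) => _ [n _ <-]. Qed.

Let S_ub u w n : clip (u n w) w <= S u w.
Proof.
apply: ub_le_sup; last by exists n.
by exists (hi w) => _ [k _ <-].
Qed.

Let S_le u w c : (forall n, clip (u n w) w <= c) -> S u w <= c.
Proof.
move=> h; apply: ge_sup; first by exists (clip (u 0%N w) w); exists 0%N.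
by move=> _ [k _ <-].
Qed.

Let mS u : measurable_fun [set: T] (S u).
Proof.
apply: measurable_fun_sups => [w _|n]; first exact: has_ub.
have mlo : measurable_fun [set: T] lo by exact: measurable_L0R.
have mb : measurable_fun [set: T] b by exact: measurable_L0R.
have mu : measurable_fun [set: T] (u n) by exact: measurable_L0R.
by apply: measurable_minr; apply: measurable_maxr.
Qed.

Let scale (w : T) : R := (1 + (hi w - lo w))^-1.

Let scale_gt0 w : 0 < scale w.
Proof. by rewrite invr_gt0 ltr_pwDl// subr_ge0. Qed.

Let mscale : measurable_fun [set: T] scale.
Proof.
have mlo : measurable_fun [set: T] lo by exact: measurable_L0R.
have mb : measurable_fun [set: T] b by exact: measurable_L0R.
apply: (measurableT_comp (@measurable_invr R)).
apply: measurable_funD => //; apply: measurable_funB => //.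
exact: measurable_maxr.
Qed.

Let psi u w : R := (S u w - lo w) * scale w.

Let mpsi u : measurable_fun [set: T] (psi u).
Proof.
apply: measurable_funM; last exact: mscale.
by apply: measurable_funB; [exact: mS|exact: measurable_L0R].
Qed.

Let mEpsi u : measurable_fun [set: T] (EFin \o psi u).
Proof. by apply/measurable_EFinP; exact: mpsi. Qed.

Let psi_ge0 u w : 0 <= psi u w.
Proof.
apply: mulr_ge0; last exact: ltW.
by rewrite subr_ge0 (le_trans _ (S_ub u w 0)).
Qed.

Let psi_le1 u w : psi u w <= 1.
Proof.
rewrite /psi /scale ler_pdivrMr; last by rewrite ltr_pwDl// subr_ge0.
rewrite mul1r (@le_trans _ _ (hi w - lo w))//; last by rewrite lerDr.
by rewrite lerD2r; exact: S_le.
Qed.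

Let psi_le u v w : S u w <= S v w -> psi u w <= psi v w.
Proof. by move=> uv; apply: ler_wpM2r; [exact: ltW|rewrite lerD2r]. Qed.

Let I u : \bar R := (\int[P]_w (psi u w)%:E)%E.

Let I_le u v : (forall w, S u w <= S v w) -> (I u <= I v)%E.
Proof.
move=> uv; apply: ge0_le_integral => //.
- by move=> w _; rewrite lee_fin.
- exact: mEpsi.
- exact: mEpsi.
- by move=> w _; rewrite lee_fin; exact: psi_le.
Qed.

Let I_ge0 u : (0 <= I u)%E.
Proof. by apply: integral_ge0 => w _; rewrite lee_fin. Qed.

Let I_le1 u : (I u <= 1)%E.
Proof.
have -> : (1 = \int[P]_w cst 1 w :> \bar R)%E.
  by rewrite integral_cst// mul1e -[X in _ = X]/(P [set: T]) probability_setT.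
apply: ge0_le_integral => //.
- by move=> w _; rewrite lee_fin.
- exact: mEpsi.
- by move=> w _; rewrite lee_fin.
Qed.

Let seqs : set (L0R P)^nat := [set u | forall n, A (u n)].
Let M : \bar R := ereal_sup [set I u | u in seqs].

Let I_leM u : seqs u -> (I u <= M)%E.
Proof. by move=> su; apply: ereal_sup_ubound; exists u. Qed.

Let M_fin : M \is a fin_num.
Proof.
rewrite ge0_fin_numE; last first.
  by apply: (le_trans (I_ge0 (fun=> f0))); apply: I_leM => n.
rewrite (@le_lt_trans _ _ 1%E)// ?ltry//.
by apply: ge_ereal_sup => _ [u _ <-].
Qed.

Let maximizing : exists2 u, seqs u & I u = M.
Proof.
have near_M k : exists2 u, seqs u & (M - k.+1%:R^-1%:E < I u)%E.
  have : (M - k.+1%:R^-1%:E < M)%E.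
    by rewrite lteBlDr// -[X in (X < _)%E]adde0 lteD2lE// lte_fin invr_gt0.
  by move=> /ereal_sup_gt[_ [u su <-]]; exists u.
have [v vP] := choice (fun k => let: ex_intro2 u a c := near_M k in
  ex_intro (fun u => seqs u /\ (M - k.+1%:R^-1%:E < I u)%E) u (conj a c)).
pose u m := let: (k, n) := odflt (0, 0)%N (unpickle m) in v k n.
have su : seqs u.
  by move=> m; rewrite /u; case: (odflt _ _) => k n; exact: (vP k).1.
exists u => //; apply/eqP; rewrite eq_le I_leM//=.
have vu k w : S (v k) w <= S u w.
  apply: S_le => n; rewrite (le_trans _ (S_ub u w (pickle (k, n))))//.
  by rewrite /u pickleK.
apply/lee_addgt0Pr => e e0.
have [k _ ke] := near_infty_natSinv_lt (PosNum e0).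
have := (vP k).2; rewrite lteBlDr// => /ltW/le_trans; apply.
apply: leeD; first exact: I_le.
by rewrite lee_fin ltW//; exact: (ke k (leqnn k)).
Qed.

Lemma L0R_supremum_exists : supremums A !=set0.
Proof.
have [u su uM] := maximizing.
exists (L0R_class P (mS u)); split => [f Af|c Ac]; apply/L0R_leP; last first.
  have h : \forall w \ae P, forall n, u n w <= (c : L0R P) w.
    by apply: ae_foralln => n; apply/L0R_leP; exact/Ac/su.
  have /L0R_leP h0 := Ac _ Af0; near=> w.
  rewrite (near (L0R_classE P (mS u)) w)//; apply: S_le => n.
  rewrite ge_min ge_max (near h w)//=.
  by apply/orP; left; exact: (near h0 w).
pose v n := if n is m.+1 then u m else f.
have sv : seqs v by case=> [|n]; [exact: Af|exact: su].
have uv w : S u w <= S v w.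
  by apply: S_le => n; exact: (S_ub v w n.+1).
have Ivu : I v = I u.
  by apply/eqP; rewrite eq_le (I_le uv) andbT uM I_leM.
have diff0 : (\int[P]_w (psi v w - psi u w)%:E = 0)%E.
  have : (I v = I u + \int[P]_w (psi v w - psi u w)%:E)%E.
    rewrite /I -ge0_integralD//=.
    - by apply: eq_integral => w _; rewrite -EFinD addrC subrK.
    - by move=> w _; rewrite lee_fin.
    - exact: mEpsi.
    - by move=> w _; rewrite lee_fin subr_ge0; exact: psi_le.
    - by apply/measurable_EFinP; apply: measurable_funB; exact: mpsi.
  have : I u \is a fin_num by rewrite uM.
  rewrite Ivu; case: (I u) => // r _.
  set X := (\int[P]_w (_ - _)%:E)%E.
  by case: X => //= x [] /esym/eqP; rewrite -subr_eq0 addrAC subrr add0r => /eqP ->.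
have mdiff : measurable_fun [set: T] (fun w => (psi v w - psi u w)%:E).
  by apply/measurable_EFinP; apply: measurable_funB; exact: mpsi.
have diffE : (\int[P]_w `|(psi v w - psi u w)%:E| = 0)%E.
  rewrite -[RHS]diff0; apply: eq_integral => w _.
  by rewrite gee0_abs// lee_fin subr_ge0; exact: psi_le.
have /(ae_eq_integral_abs P measurableT mdiff).1 h := diffE.
have /L0R_leP fb := Ab Af.
near=> w.
have : psi v w - psi u w = 0.
  by apply: EFin_inj; exact: (near h w).
move=> /eqP; rewrite subr_eq0 => /eqP/(mulIf (lt0r_neq0 (scale_gt0 w))).
move=> /addIr vuw.
rewrite (near (L0R_classE P (mS u)) w)// -vuw (le_trans _ (S_ub v w 0))//=.
rewrite le_min le_max lexx/= /hi le_max.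
by apply/orP; right; exact: (near fb w).
Unshelve. all: by end_near. Qed.

End Dedekind_completeness.

Section L0R_supremum.
Context d (T : measurableType d) (R : realType) (P : probability T R).

Lemma L0R_supremumP (A : set (L0R P)) (x : L0R P) :
  A !=set0 -> ubound A !=set0 -> supremums A (supremum x A).
Proof.
move=> [f0 Af0] [b Ab]; have [s As] := L0R_supremum_exists Af0 Ab.
rewrite /supremum ifF; first by apply: xgetPex; exists s.
by apply/eqP => A0; move: Af0; rewrite A0.
Qed.

End L0R_supremum.

Section L0_abs_theory.
Context d (T : measurableType d) (R : realType) (P : probability T R).
Implicit Types (f g : L0C P) (r s t : L0R P).
Local Notation normc := (@ComplexField.Normc.normc R).

Lemma normc_ge0 (z : R[i]) : 0 <= normc z.
Proof. by case: z => a b; exact: sqrtr_ge0. Qed.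

Lemma normcD (x y : R[i]) : normc (x + y) <= normc x + normc y.
Proof.
have h (z : R[i]) : `|z| = (normc z)%:C%C by [].
by rewrite -lecR rmorphD/= -!h ler_normD.
Qed.

Lemma L0_abs_ge0 f : 0 <= L0_abs f.
Proof.
apply/L0R_leP; near=> w.
rewrite (near (L0R_0E P) w)// (near (L0_absE f) w)//.
exact: normc_ge0.
Unshelve. all: by end_near. Qed.

Lemma L0_absM f g : L0_abs (f * g) = L0_abs f * L0_abs g.
Proof.
apply: L0R_eqP; near=> w.
rewrite (near (L0_absE (f * g)) w)// (near (L0R_ME (L0_abs f) (L0_abs g)) w)//.
rewrite (near (L0_absE f) w)// (near (L0_absE g) w)// (near (L0C_ME f g) w)//.
exact: ComplexField.Normc.normcM.
Unshelve. all: by end_near. Qed.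

Lemma L0_absD f g : L0_abs (f + g) <= L0_abs f + L0_abs g.
Proof.
apply/L0R_leP; near=> w.
rewrite (near (L0_absE (f + g)) w)// (near (L0R_DE (L0_abs f) (L0_abs g)) w)//.
rewrite (near (L0_absE f) w)// (near (L0_absE g) w)// (near (L0C_DE f g) w)//.
exact: normcD.
Unshelve. all: by end_near. Qed.

Lemma L0_abs0 : L0_abs (0 : L0C P) = 0.
Proof.
apply: L0R_eqP; near=> w.
rewrite (near (L0_absE (0 : L0C P)) w)// (near (L0C_0E P) w)//.
by rewrite (near (L0R_0E P) w)// ComplexField.Normc.normc0.
Unshelve. all: by end_near. Qed.

Lemma L0_abs_le0 f : L0_abs f <= 0 -> f = 0.
Proof.
move=> /L0R_leP f0; apply: L0C_eqP; near=> w.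
rewrite (near (L0C_0E P) w)//; apply: ComplexField.Normc.eq0_normc.
apply/eqP; rewrite eq_le normc_ge0 andbT.
rewrite -(near (L0_absE f) w)// -(near (L0R_0E P) w)//; exact: (near f0 w).
Unshelve. all: by end_near. Qed.

Lemma L0R_lerD r s r' s' : r <= r' -> s <= s' -> r + s <= r' + s'.
Proof.
move=> /L0R_leP rr' /L0R_leP ss'; apply/L0R_leP; near=> w.
rewrite (near (L0R_DE r s) w)// (near (L0R_DE r' s') w)//.
by apply: lerD; [exact: (near rr' w)|exact: (near ss' w)].
Unshelve. all: by end_near. Qed.

Lemma L0R_ler_wpM r s r' s' :
  0 <= r -> 0 <= s -> r <= r' -> s <= s' -> r * s <= r' * s'.
Proof.
move=> /L0R_leP r0 /L0R_leP s0 /L0R_leP rr' /L0R_leP ss'.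
apply/L0R_leP; near=> w.
rewrite (near (L0R_ME r s) w)// (near (L0R_ME r' s') w)//.
have z := near (L0R_0E P) w.
apply: ler_pM; rewrite -?z//;
  [exact: (near r0 w)|exact: (near s0 w)|exact: (near rr' w)|exact: (near ss' w)].
Unshelve. all: by end_near. Qed.

Lemma L0R_mulr_ge0 r s : 0 <= r -> 0 <= s -> 0 <= r * s.
Proof. by move=> r0 s0; rewrite -[0](mulr0 0); exact: L0R_ler_wpM. Qed.

Lemma L0R_addr_ge0 r s : 0 <= r -> 0 <= s -> 0 <= r + s.
Proof. by move=> r0 s0; rewrite -[0](addr0 0); exact: L0R_lerD. Qed.

End L0_abs_theory.

(* Random normed modules over C with base (T, P). *)
HB.mixin Record isRNModule d (T : measurableType d) (R : realType)
    (P : probability T R) (E : Type) of GRing.Lmodule (L0C P) E := {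
  rnorm : E -> L0R P ;
  rnorm_ge0 : forall x : E, 0 <= rnorm x ;
  rnorm_eq0 : forall x : E, rnorm x = 0 <-> x = 0 ;
  rnormZ : forall (xi : L0C P) (x : E), rnorm (xi *: x) = L0_abs xi * rnorm x ;
  ler_rnormD : forall x y : E, rnorm (x + y) <= rnorm x + rnorm y
}.

#[short(type="rnModType")]
HB.structure Definition RNModule d (T : measurableType d) (R : realType)
    (P : probability T R) :=
  {E of isRNModule d T R P E & GRing.Lmodule (L0C P) E}.

Definition countable_concatenation d (T : measurableType d) (R : realType)
    (P : probability T R) (E : rnModType P) : Prop :=
  forall (x : nat -> E) (A : nat -> set T) (mA : forall n, measurable (A n)),
    trivIset [set: nat] A -> \bigcup_n A n = [set: T] ->
    exists z : E, forall n, L0_indic P (mA n) *: z = L0_indic P (mA n) *: x n.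

Section random_conjugate_space.
Context d (T : measurableType d) (R : realType) (P : probability T R).
Variable E : rnModType P.

Definition as_bounded (f : E -> L0C P) : Prop :=
  exists2 xi : L0R P, 0 <= xi & forall x : E, L0_abs (f x) <= xi * rnorm x.

Definition rdual_pred : {pred E -> (L0C P)^o} :=
  [pred f : E -> (L0C P)^o | `[< scalar f /\ as_bounded f >] ].

(* Linearity is over the algebra L0C. For a.s. bounded maps it is equivalent to
   linearity over C, see bounded_complex_linear_scalar below. *)
Record rdual : Type := RDual {
  rdual_fun :> E -> (L0C P)^o ;
  rdual_funP : rdual_fun \in rdual_pred
}.

HB.instance Definition _ := [isSub for rdual_fun].
HB.instance Definition _ := [Choice of rdual by <:].

Lemma rdual_predP f : reflect (scalar f /\ as_bounded f) (f \in rdual_pred).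
Proof. exact: asboolP. Qed.

Lemma rdual_submod_closed : submod_closed rdual_pred.
Proof.
split=> [|a f g].
  apply/rdual_predP; split=> [c x y|]; first by rewrite mulr0 addr0.
  by exists 0 => // x; rewrite L0_abs0 mul0r.
move=> /rdual_predP[lf [xi xi0 bf]] /rdual_predP[lg [eta eta0 bg]].
apply/rdual_predP; split=> [c x y|].
  rewrite -![(_ + _ : E -> _) _]/(_ + _) -![(_ *: _ : E -> _) _]/(_ * _).
  rewrite lf lg !mulrDr !mulrA (mulrC a c) -!addrA. congr (_ + _). by rewrite addrCA.
exists (L0_abs a * xi + eta) => [|x].
  by apply: L0R_addr_ge0 => //; apply: L0R_mulr_ge0 => //; exact: L0_abs_ge0.
apply: (le_trans (L0_absD _ _)); rewrite mulrDl L0_absM -mulrA.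
by apply: L0R_lerD => //; apply: L0R_ler_wpM => //; exact: L0_abs_ge0.
Qed.

End random_conjugate_space.

Section bounded_complex_linear.
Context d (T : measurableType d) (R : realType) (P : probability T R).
Variable E : rnModType P.
Local Notation normc := (@ComplexField.Normc.normc R).

Definition L0_cst (z : R[i]) : L0C P := L0C_class P (measurable_cst z).

Let rat_approx (z : R[i]) (e : R) : 0 < e ->
  exists pq : rat * rat, normc (z - (ratr pq.1 +i* ratr pq.2)%C) < e.
Proof.
move=> e0; case: z => a b.
have e2 : 0 < e / 2 by rewrite divr_gt0.
have near_rat (r : R) : exists q : rat, `|r - ratr q| < e / 2.
  have /rat_in_itvoo[q] : r - e / 2 < r + e / 2 by rewrite ltrD2l gtrN.
  rewrite in_itv/= => /andP[h1 h2]; exists q.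
  by rewrite ltr_distlC h1 h2.
have [p hp] := near_rat a; have [q hq] := near_rat b.
exists (p, q); rewrite [(p, q).1]/= [(p, q).2]/=.
pose u := a - ratr p; pose v := b - ratr q.
have -> : (a +i* b)%C - (ratr p +i* ratr q)%C = (u +i* 0)%C + (0 +i* v)%C :> R[i].
  by apply/eqP; rewrite eq_complex /= addr0 add0r !eqxx.
apply: (le_lt_trans (normcD _ _)); rewrite /= !expr0n/= addr0 add0r !sqrtr_sqr.
by rewrite [ltRHS](splitr e) ltrD.
Qed.

Lemma bounded_complex_linear_scalar (f : E -> L0C P) :
  (forall z x y, f (L0_cst z *: x + y) = L0_cst z * f x + f y) ->
  as_bounded f -> scalar (f : E -> (L0C P)^o).
Proof.
move=> fl [xi xi0 fb].
have cst1 : L0_cst 1 = 1 by [].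
have fD x y : f (x + y) = f x + f y.
  by have := fl 1 x y; rewrite cst1 scale1r mul1r.
have f0 : f 0 = 0.
  have /eqP := fD 0 0.
  by rewrite addr0 -subr_eq0 opprD addrA subrr sub0r oppr_eq0 => /eqP.
have fZ z x : f (L0_cst z *: x) = L0_cst z * f x.
  by have := fl z x 0; rewrite f0 !addr0.
have fN x : f (- x) = - f x.
  by apply/eqP; rewrite -addr_eq0 -fD addNr f0.
suff hom (c : L0C P) x : f (c *: x) = c * f x by move=> c x y; rewrite fD hom.
pose B : L0R P := xi * rnorm x + L0_abs (f x).
have approx z : L0_abs (f (c *: x) - c * f x) <= L0_abs (c - L0_cst z) * B.
  have -> : f (c *: x) - c * f x =
      f ((c - L0_cst z) *: x) + (L0_cst z - c) * f x.
    by rewrite scalerBl fD fN fZ mulrBl addrA addrNK.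
  apply: (le_trans (L0_absD _ _)); rewrite mulrDr; apply: L0R_lerD.
    by rewrite (le_trans (fb _))// rnormZ mulrCA.
  rewrite L0_absM (_ : L0_abs (L0_cst z - c) = L0_abs (c - L0_cst z))//.
  apply: L0R_eqP; near=> w.
  rewrite (near (L0_absE (L0_cst z - c)) w)// (near (L0_absE (c - L0_cst z)) w)//.
  rewrite (near (L0C_DE (L0_cst z) (- c)) w)// (near (L0C_DE c (- L0_cst z)) w)//.
  rewrite (near (L0C_NE (L0_cst z)) w)// (near (L0C_NE c) w)// -opprB.
  by case: (c w - L0_cst z w) => u v /=; rewrite !sqrrN.
pose rat_cst (n : nat) : R[i] :=
  let pq := odflt (0, 0) (unpickle n : option (rat * rat)) in
  (ratr pq.1 +i* ratr pq.2)%C.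
have B0 : 0 <= B.
  by apply: L0R_addr_ge0; [apply: L0R_mulr_ge0 => //; exact: rnorm_ge0
                          |exact: L0_abs_ge0].
have /L0R_leP B0P := B0.
have ae_approx : \forall w \ae P, forall n,
    normc ((f (c *: x) - c * f x : L0C P) w) <= normc (c w - rat_cst n) * B w.
  apply: ae_foralln => n; have /L0R_leP h := approx (rat_cst n).
  near=> w.
  have : L0_abs (f (c *: x) - c * f x) w
         <= (L0_abs (c - L0_cst (rat_cst n)) * B : L0R P) w by exact: (near h w).
  rewrite (near (L0_absE (f (c *: x) - c * f x)) w)//.
  rewrite (near (L0R_ME (L0_abs (c - L0_cst (rat_cst n))) B) w)//.
  rewrite (near (L0_absE (c - L0_cst (rat_cst n))) w)//.
  rewrite (near (L0C_DE c (- L0_cst (rat_cst n))) w)//.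
  rewrite (near (L0C_NE (L0_cst (rat_cst n))) w)//.
  by rewrite (near (L0C_classE P (measurable_cst (rat_cst n))) w).
apply/eqP; rewrite -subr_eq0; apply/eqP; apply: L0C_eqP; near=> w.
rewrite (near (L0C_0E P) w)//; apply: ComplexField.Normc.eq0_normc.
apply/eqP; rewrite eq_le normc_ge0 andbT.
have Bw : 0 <= B w by rewrite -[leLHS](near (L0R_0E P) w)//; exact: (near B0P w).
have hw n : normc ((f (c *: x) - c * f x : L0C P) w)
    <= normc (c w - rat_cst n) * B w.
  by have : forall n, normc ((f (c *: x) - c * f x : L0C P) w)
    <= normc (c w - rat_cst n) * B w by exact: (near ae_approx w).
apply/ler_addgt0Pr => e e0; rewrite add0r.
have eB : 0 < e / (B w + 1) by rewrite divr_gt0// ltr_wpDl.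
have [pq hpq] := rat_approx (c w) eB.
apply: (le_trans (hw (pickle pq))); rewrite /rat_cst pickleK/=.
apply: (@le_trans _ _ (e / (B w + 1) * (B w + 1))).
  by apply: ler_pM => //; [exact: normc_ge0|exact: ltW|rewrite lerDl].
by rewrite divfK// gt_eqF// ltr_wpDl.
Unshelve. all: by end_near. Qed.

End bounded_complex_linear.

Section random_conjugate_space_structure.
Context d (T : measurableType d) (R : realType) (P : probability T R).
Variable E : rnModType P.
Local Notation normc := (@ComplexField.Normc.normc R).

HB.instance Definition _ :=
  GRing.isSubmodClosed.Build (L0C P) (E -> (L0C P)^o) (@rdual_pred _ _ _ _ E)
    (@rdual_submod_closed _ _ _ _ E).
HB.instance Definition _ := [SubChoice_isSubLmodule of rdual E by <:].

Implicit Types (f g : rdual E) (x y : E).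

Lemma rdualE f g : (forall x, f x = g x) -> f = g.
Proof. by move=> fg; apply/val_inj/funext. Qed.

Lemma rdual_addE f g x : (f + g) x = f x + g x. Proof. by []. Qed.
Lemma rdual_scaleE (c : L0C P) f x : (c *: f) x = c * f x. Proof. by []. Qed.
Lemma rdual0E x : (0 : rdual E) x = 0. Proof. by []. Qed.

Lemma rdual_scalar f : scalar f.
Proof. by have /rdual_predP[] := rdual_funP f. Qed.

Lemma rdual_bounded f : as_bounded f.
Proof. by have /rdual_predP[] := rdual_funP f. Qed.

Lemma rdual_lin0 f : f 0 = 0.
Proof.
have := rdual_scalar f 1 0 0; rewrite scale1r mul1r addr0 => /eqP.
by rewrite -subr_eq0 opprD addrA subrr sub0r oppr_eq0 => /eqP.
Qed.

Lemma rdual_linZ f c x : f (c *: x) = c * f x.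
Proof. by have := rdual_scalar f c x 0; rewrite rdual_lin0 !addr0. Qed.

Lemma rnorm0 : rnorm (0 : E) = 0.
Proof. by apply/rnorm_eq0. Qed.

Lemma L0R_le01 : 0 <= (1 : L0R P).
Proof.
apply/L0R_leP; near=> w; rewrite (near (L0R_0E P) w)// (near (L0R_1E P) w)//.
Unshelve. all: by end_near. Qed.

Definition rdual_ball_values f : set (L0R P) :=
  [set L0_abs (f y) | y in [set y | rnorm y <= 1]].

(* The supremum is taken in the order of L0R; it exists by rdual_normP, so that
   the default value 0 is never used. *)
Definition rdual_norm f : L0R P := supremum 0 (rdual_ball_values f).

Lemma rdual_normP f : supremums (rdual_ball_values f) (rdual_norm f).
Proof.
apply: L0R_supremumP.
  by exists (L0_abs (f 0)); exists 0 => //=; rewrite rnorm0 L0R_le01.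
have [xi xi0 bf] := rdual_bounded f.
exists xi => _ [y /= y1 <-]; apply: (le_trans (bf y)).
by rewrite -[leRHS]mulr1; apply: L0R_ler_wpM => //; exact: rnorm_ge0.
Qed.

Lemma rdual_norm_ub f y : rnorm y <= 1 -> L0_abs (f y) <= rdual_norm f.
Proof. by move=> y1; apply: (rdual_normP f).1; exists y. Qed.

Lemma rdual_norm_least f s :
  (forall y, rnorm y <= 1 -> L0_abs (f y) <= s) -> rdual_norm f <= s.
Proof. by move=> h; apply: (rdual_normP f).2 => _ [y y1 <-]; exact: h. Qed.

Lemma rdual_norm_ge0 f : 0 <= rdual_norm f.
Proof.
have := @rdual_norm_ub f 0; rewrite rnorm0 rdual_lin0 L0_abs0.
by apply; exact: L0R_le01.
Qed.

Let minv (r : L0R P) : measurable_fun [set: T] (fun w => ((r w)^-1)%:C%C).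
Proof.
apply/measurable_complexP; split => //=.
by apply: (measurableT_comp (@measurable_invr R)); exact: measurable_L0R.
Qed.

Let inv (r : L0R P) : L0C P := L0C_class P (minv r).

Let normcR (a : R) : normc a%:C%C = `|a|.
Proof. by rewrite /= expr0n/= addr0 sqrtr_sqr. Qed.

Let abs_invE (r : L0R P) : 0 <= r ->
  \forall w \ae P, L0_abs (inv r) w = (r w)^-1.
Proof.
move=> /L0R_leP r0; near=> w.
rewrite (near (L0_absE (inv r)) w)// (near (L0C_classE P (minv r)) w)// normcR.
by rewrite ger0_norm// invr_ge0 -(near (L0R_0E P) w)//; exact: (near r0 w).
Unshelve. all: by end_near. Qed.

Lemma rdual_norm_le f x : L0_abs (f x) <= rdual_norm f * rnorm x.
Proof.
have r0 := rnorm_ge0 x; have r0P := (L0R_leP _ _).2 r0.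
have [xi xi0 bf] := rdual_bounded f.
have i1 : rnorm (inv (rnorm x) *: x) <= 1.
  rewrite rnormZ; apply/L0R_leP; near=> w.
  rewrite (near (L0R_ME (L0_abs (inv (rnorm x))) (rnorm x)) w)//.
  rewrite (near (abs_invE r0) w)// (near (L0R_1E P) w)//.
  have [->|n0] := eqVneq (rnorm x w) 0; first by rewrite mulr0.
  by rewrite mulVf.
have /L0R_leP := rdual_norm_ub f i1; rewrite rdual_linZ L0_absM => h.
have /L0R_leP b := bf x.
apply/L0R_leP; near=> w.
rewrite (near (L0R_ME (rdual_norm f) (rnorm x)) w)//.
have [e|n0] := eqVneq (rnorm x w) 0.
  have : L0_abs (f x) w <= (xi * rnorm x : L0R P) w by exact: (near b w).
  by rewrite (near (L0R_ME xi (rnorm x)) w)// e !mulr0.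
have rw : 0 < rnorm x w.
  rewrite lt_neqAle eq_sym n0/= -[leLHS](near (L0R_0E P) w)//.
  exact: (near r0P w).
have : (L0_abs (inv (rnorm x)) * L0_abs (f x) : L0R P) w <= rdual_norm f w.
  by exact: (near h w).
rewrite (near (L0R_ME (L0_abs (inv (rnorm x))) (L0_abs (f x))) w)//.
by rewrite (near (abs_invE r0) w)// mulrC ler_pdivrMr.
Unshelve. all: by end_near. Qed.

Let norm_eq0 f : rdual_norm f = 0 <-> f = 0.
Proof.
split=> [f0|->].
  apply: rdualE => x; apply: L0_abs_le0.
  by rewrite (le_trans (rdual_norm_le f x))// f0 mul0r.
apply: le_anti; rewrite rdual_norm_ge0 andbT.
by apply: rdual_norm_least => y _; rewrite rdual0E L0_abs0.
Qed.

Let normZ (c : L0C P) f : rdual_norm (c *: f) = L0_abs c * rdual_norm f.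
Proof.
apply: le_anti; apply/andP; split.
  apply: rdual_norm_least => y y1; rewrite rdual_scaleE L0_absM.
  apply: L0R_ler_wpM => //; [exact: L0_abs_ge0|exact: L0_abs_ge0|].
  exact: rdual_norm_ub.
pose r := L0_abs c; have r0 : 0 <= r := L0_abs_ge0 c.
have r0P := (L0R_leP _ _).2 r0.
have mZ : measurable_fun [set: T]
    (fun w => (r w)^-1 * rdual_norm (c *: f) w + \1_(r @^-1` [set 0]) w * rdual_norm f w).
  apply: measurable_funD; apply: measurable_funM; try exact: measurable_L0R.
    by apply: (measurableT_comp (@measurable_invr R)); exact: measurable_L0R.
  apply: measurable_indic; rewrite -[X in measurable X]setTI.
  by apply: (measurable_L0R r) => //; exact: measurable_set1.
have : rdual_norm f <= L0R_class P mZ.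
  apply: rdual_norm_least => y y1; apply/L0R_leP.
  have /L0R_leP h1 := rdual_norm_ub f y1.
  have /L0R_leP := rdual_norm_ub (c *: f) y1; rewrite rdual_scaleE L0_absM => h2.
  near=> w; rewrite (near (L0R_classE P mZ) w)//= indicE.
  have [e|n0] := eqVneq (r w) 0.
    rewrite mem_set//= mul1r e invr0 mul0r add0r; exact: (near h1 w).
  rewrite memNset/=; last exact/eqP.
  rewrite mul0r addr0 mulrC ler_pdivlMr; last first.
    rewrite lt_neqAle eq_sym n0/= -[leLHS](near (L0R_0E P) w)//.
    exact: (near r0P w).
  rewrite mulrC -(near (L0R_ME r (L0_abs (f y))) w)//; exact: (near h2 w).
move=> /L0R_leP h.
have /L0R_leP n0 := rdual_norm_ge0 (c *: f).
apply/L0R_leP; near=> w.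
rewrite (near (L0R_ME r (rdual_norm f)) w)//.
have [->|nz] := eqVneq (r w) 0.
  by rewrite mul0r -(near (L0R_0E P) w)//; exact: (near n0 w).
have rw : 0 < r w.
  rewrite lt_neqAle eq_sym nz/= -[leLHS](near (L0R_0E P) w)//.
  exact: (near r0P w).
have : rdual_norm f w <= L0R_class P mZ w by exact: (near h w).
rewrite (near (L0R_classE P mZ) w)//= indicE memNset/=; last exact/eqP.
by rewrite mul0r addr0 [X in _ <= X -> _]mulrC ler_pdivlMr// mulrC.
Unshelve. all: by end_near. Qed.

Let normD f g : rdual_norm (f + g) <= rdual_norm f + rdual_norm g.
Proof.
apply: rdual_norm_least => y y1; rewrite rdual_addE.
apply: (le_trans (L0_absD _ _)).
by apply: L0R_lerD; exact: rdual_norm_ub.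
Qed.

HB.instance Definition _ := isRNModule.Build d T R P (rdual E)
  rdual_norm_ge0 norm_eq0 normZ normD.

End random_conjugate_space_structure.

Section natural_embedding.
Context d (T : measurableType d) (R : realType) (P : probability T R).
Variable E : rnModType P.

Lemma rembed_subproof (x : E) :
  (fun g : rdual E => g x : (L0C P)^o) \in @rdual_pred _ _ _ _ (rdual E).
Proof.
apply/rdual_predP; split=> [c f g //|].
exists (rnorm x) => [|g]; first exact: rnorm_ge0.
by rewrite mulrC; exact: rdual_norm_le.
Qed.

Definition rembed (x : E) : rdual (rdual E) := RDual (rembed_subproof x).

Lemma rembedE (x : E) (g : rdual E) : rembed x g = g x. Proof. by []. Qed.

End natural_embedding.

Definition L0_pos d (T : measurableType d) (R : realType)
  (P : probability T R) : set (L0R P) := [set e | \forall w \ae P, 0 < e w].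

Section weak_star.
Context d (T : measurableType d) (R : realType) (P : probability T R).
Variable F : rnModType P.

(* A copy of rdual F carrying the locally L0-convex weak star topology. *)
Definition weak_star : Type := rdual F.

HB.instance Definition _ := GRing.Lmodule.on weak_star.

Definition weak_star_ball n (y : 'I_n.+1 -> F) (eps : L0R P) : set (rdual F) :=
  [set g | forall i, \forall w \ae P, L0_abs (g (y i)) w < eps w].

Definition weak_star_nbhs (f : weak_star) : set_system weak_star :=
  [set A | exists n (y : 'I_n.+1 -> F) (eps : L0R P), L0_pos eps /\
    forall g, weak_star_ball y eps g -> A (f + g)].

HB.instance Definition _ := hasNbhs.Build weak_star weak_star_nbhs.

Let L0_pos_lb n (e : 'I_n -> L0R P) : (forall i, L0_pos (e i)) ->
  exists2 e' : L0R P, L0_pos e' & forall i, e' <= e i.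
Proof.
elim: n e => [|n IH] e epos.
  exists 1; last by case.
  near=> w; rewrite (near (L0R_1E P) w)//.
have [e' e'pos e'le] := IH (fun i => e (lift ord0 i)) (fun i => epos _).
have mm : measurable_fun [set: T] (fun w => Num.min (e ord0 w) (e' w)).
  by apply: measurable_minr; exact: measurable_L0R.
have e0 := epos ord0.
exists (L0R_class P mm) => [|i].
  near=> w; rewrite (near (L0R_classE P mm) w)// lt_min.
  by apply/andP; split; [exact: (near e0 w)|exact: (near e'pos w)].
case: (unliftP ord0 i) => [j|] ->; apply/L0R_leP.
  have /L0R_leP h := e'le j.
  near=> w; rewrite (near (L0R_classE P mm) w)// ge_min.
  by apply/orP; right; exact: (near h w).
by near=> w; rewrite (near (L0R_classE P mm) w)// ge_min lexx.
Unshelve. all: by end_near. Qed.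

Let weak_star_filter f : ProperFilter (weak_star_nbhs f).
Proof.
split.
  case=> n [y [eps [epos]]] /(_ 0); apply => i.
  near=> w; rewrite rdual0E L0_abs0 (near (L0R_0E P) w)//; exact: (near epos w).
split.
- exists 0%N, (fun=> 0), 1; split=> //.
  by near=> w; rewrite (near (L0R_1E P) w)//.
- move=> A B [n1 [y1 [e1 [p1 h1]]]] [n2 [y2 [e2 [p2 h2]]]].
  have p12 (i : 'I_2) : L0_pos (if i == ord0 then e1 else e2) by case: ifP.
  have [e epos ele] := L0_pos_lb p12.
  have /L0R_leP l1 : e <= e1 := ele ord0.
  have /L0R_leP l2 : e <= e2 := ele (lift ord0 ord0).
  exists (n1 + n2.+1)%N, (fun i : 'I_(n1.+1 + n2.+1) =>
    match fintype.split i with inl j => y1 j | inr j => y2 j end), e.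
  split=> // g gb; split; [apply: h1 => j|apply: h2 => j].
  + have := gb (lshift n2.+1 j); rewrite (unsplitK (inl j)) => hj.
    by near=> w; apply: (lt_le_trans _ (near l1 w _)) => //; exact: (near hj w).
  + have := gb (rshift n1.+1 j); rewrite (unsplitK (inr j)) => hj.
    by near=> w; apply: (lt_le_trans _ (near l2 w _)) => //; exact: (near hj w).
- move=> A B AB [n [y [e [epos h]]]]; exists n, y, e; split=> // g gb.
  exact/AB/h.
Unshelve. all: by end_near. Qed.

Let weak_star_singleton f A : weak_star_nbhs f A -> A f.
Proof.
case=> n [y [eps [epos]]] /(_ 0); rewrite addr0; apply => i.
near=> w; rewrite rdual0E L0_abs0 (near (L0R_0E P) w)//; exact: (near epos w).
Unshelve. all: by end_near. Qed.

Let weak_star_nbhs_nbhs f A :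
  weak_star_nbhs f A -> weak_star_nbhs f (weak_star_nbhs^~ A).
Proof.
case=> n [y [eps [epos h]]]; exists n, y, eps; split=> // g gb.
pose dl i : L0R P := eps - L0_abs (g (y i)).
have dlE i : \forall w \ae P, dl i w = eps w - L0_abs (g (y i)) w.
  near=> w; rewrite (near (L0R_DE eps (- L0_abs (g (y i)))) w)//.
  by rewrite (near (L0R_NE (L0_abs (g (y i)))) w).
have [e e0 ele] : exists2 e : L0R P, L0_pos e & forall i, e <= dl i.
  apply: L0_pos_lb => i; have gi := gb i.
  by near=> w; rewrite (near (dlE i) w)// subr_gt0; exact: (near gi w).
exists n, y, e; split=> // k kb; rewrite -addrA; apply: h => i.
have ki := kb i; have /L0R_leP ei := ele i.
have /L0R_leP tri := L0_absD (g (y i)) (k (y i)).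
near=> w; rewrite rdual_addE.
apply: (@le_lt_trans _ _ ((L0_abs (g (y i)) + L0_abs (k (y i)) : L0R P) w)).
  exact: (near tri w).
rewrite (near (L0R_DE (L0_abs (g (y i))) (L0_abs (k (y i)))) w)//.
rewrite -ltrBrDl -(near (dlE i) w)//.
by apply: (@lt_le_trans _ _ (e w)); [exact: (near ki w)|exact: (near ei w)].
Unshelve. all: by end_near. Qed.

HB.instance Definition _ := Nbhs_isNbhsTopological.Build weak_star
  weak_star_filter weak_star_singleton weak_star_nbhs_nbhs.

End weak_star.

(* Main.v *)
(** Every [Phi] in the second dual agrees exactly with a [J x] on any finite
    list [g :: s] of functionals, by elimination of the first one: if some [e]
    satisfies [g e *: g = g], apply induction to the functionals
    [h - h e *: g], [h] in [s], to get [y], and take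
    [x = y + (Phi g - g y) *: e].  Such an [e] exists because the measurable
    sets [A] on which some [e] has [g e = 1_A] are stable under countable
    unions (countable concatenation), so that one of them has maximal
    probability; as this class contains [{g x != 0}] for all [x], [g] vanishes
    off the maximal set. *)
Require Import Defs.
From mathcomp Require Import all_boot all_order all_algebra.
From mathcomp Require Import complex.
From mathcomp Require Import all_classical all_reals all_analysis.
From mathcomp Require Import measurable_realfun ring.

Import Order.TTheory GRing.Theory Num.Theory.

Local Open Scope classical_set_scope.
Local Open Scope ring_scope.

(** Both parts of [z^-1] are rational in [Re z] and [Im z] with denominator [|z|^2]; the convention
    [0^-1 = 0] covers the origin. *)
Lemma measurable_invc (R : realType) :
  measurable_fun [set: R[i]] (@GRing.inv R[i]).
Proof.
have mn2 : measurable_fun [set: R[i]]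
    (fun z : R[i] => (complex.Re z ^+ 2 + complex.Im z ^+ 2)^-1).
  apply: (measurableT_comp (@measurable_invr R)).
  by apply: measurable_funD; apply: measurable_funX;
    [exact: measurable_Re|exact: measurable_Im].
apply/measurable_complexP; split.
- rewrite (_ : (fun _ => _) =
    (@complex.Re R) \* (fun z => (complex.Re z ^+ 2 + complex.Im z ^+ 2)^-1)).
    by apply: measurable_funM => //; exact: measurable_Re.
  by apply/funext => -[a b].
- rewrite (_ : (fun _ => _) =
    -%R \o ((@complex.Im R) \* (fun z => (complex.Re z ^+ 2 + complex.Im z ^+ 2)^-1))).
    apply: (measurableT_comp (@oppr_measurable R setT)).
    by apply: measurable_funM => //; exact: measurable_Im.
  by apply/funext => -[a b].
Qed.

Section unit_support.
Context {d : measure_display} {T : measurableType d} {R : realType}.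
Context {P : probability T R} {E : rnModType P}.
Implicit Types (g : rdual E) (A : set T) (x e : E).

Definition unit_on g : set (set T) :=
  [set A | measurable A /\
    exists e, \forall w \ae P, (g e : L0C P) w = (\1_A w)%:C%C].

Definition L0C_supp (f : L0C P) : set T := [set w | f w != 0].

Lemma measurable_L0C_supp (f : L0C P) : measurable (L0C_supp f).
Proof.
have m0 : measurable [set z : R[i] | z != 0].
  have -> : [set z : R[i] | z != 0] =
      ~` (@complex.Re R @^-1` [set 0] `&` @complex.Im R @^-1` [set 0]).
    apply/seteqP; split=> -[a b] /=.
      by move/eqP=> ab [a0 b0]; apply: ab; rewrite a0 b0.
    by move=> ab; apply/eqP => -[a0 b0]; apply: ab.
  have mRe0 := @measurable_Re R measurableT _ (measurable_set1 0).
  have mIm0 := @measurable_Im R measurableT _ (measurable_set1 0).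
  by apply: measurableC; apply: measurableI; rewrite -[X in measurable X]setTI.
by rewrite -[X in measurable X]setTI; exact: (measurable_L0C f measurableT m0).
Qed.

(** Rescaling [x] by the pointwise inverse of [g x] works: since [0^-1 = 0], the product is 1 on the
    support and 0 off it. *)
Lemma unit_on_supp g x : unit_on g (L0C_supp (g x)).
Proof.
split; first exact: measurable_L0C_supp.
pose f : L0C P := g x.
have mi : measurable_fun [set: T] (fun w => (f w)^-1).
  exact: (measurableT_comp (@measurable_invc R) (measurable_L0C f)).
pose i := L0C_class P mi; exists (i *: x).
rewrite rdual_linZ; near=> w.
rewrite (near (L0C_ME i f) w)// (near (L0C_classE P mi) w)// indicE.
rewrite -/f; have [f0|f0] := eqVneq (f w) 0.
  by rewrite f0 mulr0 memNset// /L0C_supp/= f0 eqxx.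
by rewrite mulVf// mem_set.
Unshelve. all: by end_near. Qed.

(** The union is made disjoint and the witnesses are glued along the pieces; [g] respects gluing
    because it is linear over [L0C]. *)
Lemma unit_on_bigcup g (A : (set T)^nat) : countable_concatenation E ->
  (forall n, unit_on g (A n)) -> unit_on g (\bigcup_n A n).
Proof.
move=> hE gA; have mA n : measurable (A n) := (gA n).1.
have mU : measurable (\bigcup_n A n) by exact: bigcup_measurable.
split=> //; have [e eP] := choice (fun n => (gA n).2).
(* Index 0 is reserved for the complement of the union, where the glued element is 0; the disjoint
   pieces are shifted by one. *)
pose B n := if n is m.+1 then seqDU A m else ~` \bigcup_n A n.
pose y n := if n is m.+1 then e m else 0.
have mB n : measurable (B n).
  case: n => [|n] /=; first exact: measurableC.
  by apply: measurableD => //; exact: bigsetU_measurable.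
have BU : \bigcup_n B n = setT.
  rewrite -subTset => w _; have [|nAw] := pselect ((\bigcup_n A n) w).
    by rewrite seqDU_bigcup_eq => -[n _ ?]; exists n.+1.
  by exists 0%N.
have tB : trivIset setT B.
  apply/trivIsetP => -[|m] [|n] _ _ //=.
  - move=> _; apply/seteqP; split=> // w [nA Dw]; apply: nA.
    by rewrite seqDU_bigcup_eq; exists n.
  - move=> _; apply/seteqP; split=> // w [Dw nA]; apply: nA.
    by rewrite seqDU_bigcup_eq; exists m.
  - rewrite eqSS => mn; have /trivIsetP h := @trivIset_seqDU _ A.
    exact: h.
have [z zP] := hE y B mB tB BU.
exists z.
have zyB : \forall w \ae P, forall n, B n w -> (g z : L0C P) w = (g (y n) : L0C P) w.
  apply: ae_foralln => n.
  have /(congr1 g) := zP n; rewrite !rdual_linZ => zPn.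
  near=> w => Bw.
  have : (L0_indic P (mB n) * g z : L0C P) w = (L0_indic P (mB n) * g (y n) : L0C P) w.
    by rewrite zPn.
  rewrite (near (L0C_ME (L0_indic P (mB n)) (g z)) w)//.
  rewrite (near (L0C_ME (L0_indic P (mB n)) (g (y n))) w)//.
  by rewrite (near (L0_indicE P (mB n)) w)// indicE mem_set// !mul1r.
have eA : \forall w \ae P, forall n, (g (e n) : L0C P) w = (\1_(A n) w)%:C%C.
  exact: ae_foralln.
near=> w.
have zyw : forall n, B n w -> (g z : L0C P) w = (g (y n) : L0C P) w.
  exact: (near zyB w).
have [[|n] _ Bw] : (\bigcup_n B n) w by rewrite BU.
  by rewrite (zyw 0%N Bw) /= rdual_lin0 (near (L0C_0E P) w)// indicE memNset//.
have Aw : A n w by case: Bw.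
have eAw : forall n, (g (e n) : L0C P) w = (\1_(A n) w)%:C%C by exact: (near eA w).
by rewrite (zyw n.+1 Bw) /= eAw !indicE !mem_set//; exists n.
Unshelve. all: by end_near. Qed.

(** Exhaustion: the union of a sequence whose probabilities approach the supremum stays in the class
    and attains it. *)
Lemma unit_on_max g : countable_concatenation E ->
  exists2 A, unit_on g A & forall B, unit_on g B -> (P B <= P A)%E.
Proof.
move=> hE; pose s := ereal_sup [set P A | A in unit_on g].
have P_les A : unit_on g A -> (P A <= s)%E.
  by move=> gA; apply: ereal_sup_ubound; exists A.
have s1 : (s <= 1)%E.
  by apply: ge_ereal_sup => _ [A [mA _] <-]; exact: probability_le1.
have s0 : (0 <= s)%E.
  exact: le_trans (measure_ge0 P _) (P_les _ (unit_on_supp g 0)).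
have sfin : s \is a fin_num.
  by rewrite ge0_fin_numE// (le_lt_trans s1)// ltry.
have near_s k : exists A, unit_on g A /\ (s - k.+1%:R^-1%:E < P A)%E.
  have : (s - k.+1%:R^-1%:E < s)%E.
    by rewrite lteBlDr// -[X in (X < _)%E]adde0 lteD2lE// lte_fin invr_gt0.
  by move=> /ereal_sup_gt[_ [A gA <-]]; exists A.
have [A AP] := choice near_s.
have gU : unit_on g (\bigcup_n A n).
  by apply: unit_on_bigcup => // n; exact: (AP n).1.
exists (\bigcup_n A n) => // B gB; apply: (le_trans (P_les _ gB)).
apply/lee_addgt0Pr => r r0.
have [k _ kr] := near_infty_natSinv_lt (PosNum r0).
have := (AP k).2; rewrite lteBlDr// => /ltW/le_trans; apply; apply: leeD.
  apply: le_measure; rewrite ?inE; [exact: (AP k).1.1|exact: gU.1|].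
  exact: bigcup_sup.
by rewrite lee_fin ltW//; exact: (kr k (leqnn k)).
Qed.

(** For [A] of maximal probability and [g e = 1_A], each [g x] vanishes a.s. off [A], so multiplying
    it by [1_A] changes nothing. The null set may depend on [x], as equality in [L0C] is checked for
    one [x] at a time. *)
Lemma rdual_unit g : countable_concatenation E ->
  exists e : E, (g e : L0C P) *: g = g.
Proof.
move=> hE; have [A gA Amax] := unit_on_max g hE.
have [mA [e eA]] := gA; exists e; apply: rdualE => x; rewrite rdual_scaleE.
set B := L0C_supp (g x); have gB : unit_on g B by exact: unit_on_supp.
have mB := gB.1.
have gAB : unit_on g (A `|` B).
  (* The binary union is a countable one padded with empty sets, for which [e = 0] serves. *)
  rewrite -bigcup2E; apply: unit_on_bigcup => // -[|[|n]] //=.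
  split; first exact: measurable0.
  exists 0; rewrite rdual_lin0; near=> w.
  by rewrite (near (L0C_0E P) w)// indic0.
(* Maximality gives [P A + P (B \ A) <= P A], and [P A] is finite. *)
have BA0 : P (B `\` A) = 0%E.
  have mBA : measurable (B `\` A) by exact: measurableD.
  have := Amax _ gAB; rewrite -[A `|` B]setD0 -(setDv A) -setUDr.
  rewrite (measureU P mA mBA (setDIK A B)) -[leRHS]adde0.
  rewrite leeD2lE ?fin_num_measure// => BA0.
  by apply: le_anti; rewrite BA0 measure_ge0.
have BA : \forall w \ae P, B w -> A w.
  exists (B `\` A); split => //; first exact: measurableD.
  by move=> w /= /not_implyP.
apply: L0C_eqP; near=> w.
rewrite (near (L0C_ME (g e) (g x)) w)// (near eA w)// indicE.
have [gx0|gx0] := eqVneq ((g x : L0C P) w) 0; first by rewrite gx0 mulr0.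
have BAw : B w -> A w by exact: (near BA w).
by rewrite mem_set ?mul1r//; exact: BAw.
Unshelve. all: by end_near. Qed.

Lemma rembed_interpolation (Phi : rdual (rdual E)) (s : seq (rdual E)) :
  countable_concatenation E -> exists x, forall g, g \in s -> g x = Phi g.
Proof.
(* The induction is on a bound for the length, since the hypothesis is applied to the modified list
   [map elim s]. *)
move=> hE; have [n] := ubnP (size s); elim: n s => // n IH [_|g s].
  by exists 0.
rewrite ltnS => sn; have [e eg] := rdual_unit g hE.
pose elim (h : rdual E) : rdual E := (- (h e) : L0C P) *: g + h.
have elimE h x : elim h x = - (h e) * g x + h x by [].
have [|y yP] := IH (map elim s); first by rewrite size_map.
have Phi_elim h : Phi (elim h) = - (h e) * Phi g + Phi h by exact: rdual_scalar.
have egE x : g e * g x = g x by rewrite -[in RHS]eg.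
have egPhi : g e * Phi g = Phi g by rewrite -rdual_linZ eg.
(* The coefficient is fixed by [g e], by [egE] and [egPhi], so [g] takes the value [Phi g] here
   although [g e] is only an indicator. *)
exists ((Phi g - g y : L0C P) *: e + y) => h.
rewrite rdual_scalar inE => /predU1P[->|hs].
  by rewrite mulrC mulrBr egE egPhi subrK.
(* Expanded, [elim h y - Phi (elim h)] is exactly the error of the new element at [h]. *)
have /eqP := yP _ (map_f elim hs); rewrite elimE Phi_elim -subr_eq0 => /eqP eq0.
apply/eqP; rewrite -subr_eq0 -[X in _ == X]eq0; apply/eqP.
ring.
Qed.

End unit_support.

Theorem theorem4p2 (d : measure_display) (T : measurableType d) (R : realType)
    (P : probability T R) (E : rnModType P)
    (hE : countable_concatenation E) :
  closure (range (@rembed d T R P E) : set (weak_star (rdual E))) =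
  [set: weak_star (rdual E)].
Proof.
rewrite -subTset => Phi _ B [n [y [eps [eps0 ballB]]]].
have [x xP] := rembed_interpolation Phi (codom y) hE.
exists (rembed x); split; first by exists x.
(* The translate [rembed x - Phi] vanishes at every [y i], hence lies in the ball whatever the
   positive [eps]. *)
rewrite -[rembed x](subrKC (Phi : rdual (rdual E))); apply: ballB => i.
have -> : (rembed x - Phi : rdual (rdual E)) (y i) = 0.
  by apply/eqP; rewrite subr_eq0; apply/eqP; apply: xP; exact: codom_f.
near=> w; rewrite L0_abs0 (near (L0R_0E P) w)//; exact: (near eps0 w).
Unshelve. all: by end_near. Qed.
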